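(* Let $\mathcal{S} = \{(p',q') \in [0,1]^{2} : 0 < p'+q' \leqslant 1\}$. For every $(p,q) \in \mathcal{S}$, the probability of draw is $0$ in each of the percolation games V1, V2 and V3 on $\mathbb{Z}^{2}$ with parameters $p$ and $q$, whose permitted moves from $(x,y)\in\mathbb{Z}^2$ are to the vertices of $\mathrm{Out}(x,y)$, where (V1) $\mathrm{Out}(x,y) = \{(x,y+2), (x+1,y+1), (x+2,y)\}$; (V2) $\mathrm{Out}(x,y) = \{(x,y+1), (x+1,y+1), (x+2,y+1)\}$; (V3) $\mathrm{Out}(x,y) = \{(x+1,y), (x,y+1), (x-1,y+2)\}$.
   Context: Percolation game with parameters $p,q$ and move sets $\mathrm{Out}(x,y)$: each vertex of $\mathbb{Z}^{2}$ is independently assigned a random label, namely ''trap'' with probability $p$, ''target'' with probability $q$, and ''open'' with probability $r = 1-p-q$. After the labels are revealed to both players, a token is placed at an initial vertex, and two players take turns moving it; a move relocates the token from its current position $(x,y)$ to any vertex of $\mathrm{Out}(x,y)$. A player who moves the token to a trap loses immediately, and a player who moves the token to a target wins immediately. If the token never lands on a trap or a target, the game continues forever. For a given labeling, a player wins the game from a given initial vertex if she has a strategy that makes her win (in finitely many moves) against every strategy of the opponent. An initial vertex is in class $W$ if the player who moves first wins, in class $L$ if the player who moves first loses (i.e. the other player wins), and in class $D$ (draw) if neither player has a winning strategy. By convention, if the initial vertex itself is a trap it is placed in $W$, and if it is a target it is placed in $L$. The probability of draw is the probability (over the random labeling) that the initial vertex is in class $D$; by translation invariance it does not depend on the initial vertex,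 which may be taken to be the origin. *)

(* Defs.v *)
From HB Require Import structures.
From mathcomp Require Import all_boot all_order all_algebra.
From mathcomp Require Import all_classical all_reals all_analysis.

Set Implicit Arguments.
Unset Strict Implicit.
Unset Printing Implicit Defensive.

Import Order.TTheory GRing.Theory Num.Theory.

Local Open Scope classical_set_scope.
Local Open Scope ring_scope.

Notation vertex := (int * int)%type (only parsing).

Inductive label := Trap | Target | Open.

Inductive player := First | Second.

Definition other (i : player) : player :=
  match i with First => Second | Second => First end.

Definition outV1 (v : vertex) : seq vertex :=
  [:: (v.1, v.2 + 2); (v.1 + 1, v.2 + 1); (v.1 + 2, v.2)].

Definition outV2 (v : vertex) : seq vertex :=
  [:: (v.1, v.2 + 1); (v.1 + 1, v.2 + 1); (v.1 + 2, v.2 + 1)].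

Definition outV3 (v : vertex) : seq vertex :=
  [:: (v.1 + 1, v.2); (v.1, v.2 + 1); (v.1 - 1, v.2 + 2)].

(* A strategy maps the sequence of positions visited so far (initial vertex
   first, current vertex last) to the next position. *)
Definition strategy : Type := seq vertex -> vertex.

Definition legal (out : vertex -> seq vertex) (s : strategy) : Prop :=
  forall (h : seq vertex) (u : vertex), s (rcons h u) \in out u.

(* The n-th move, n >= 1, takes the token to the n-th position. *)
Definition mover (n : nat) : player := if odd n then First else Second.

(* The play is prolonged past the end of the game; [wins_play] only looks at
   it up to the first trap or target reached by a move. *)
Fixpoint history (s : player -> strategy) (v : vertex) (n : nat) :
    seq vertex :=
  match n with
  | 0%N => [:: v]
  | m.+1 => let h := history s v m in rcons h (s (mover m.+1) h)
  end.

Definition token (s : player -> strategy) (v : vertex) (n : nat) :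
    vertex := last v (history s v n).

Definition wins_play (lab : vertex -> label) (s : player -> strategy)
    (v : vertex) (i : player) : Prop :=
  exists n : nat, [/\ (0 < n)%N,
    forall k : nat, (0 < k < n)%N -> lab (token s v k) = Open &
    (mover n = i /\ lab (token s v n) = Target) \/
    (mover n = other i /\ lab (token s v n) = Trap)].

Definition wins_game (out : vertex -> seq vertex)
    (lab : vertex -> label) (v : vertex) (i : player) : Prop :=
  exists si : strategy, legal out si /\
    forall s : player -> strategy, s i = si -> legal out (s (other i)) ->
      wins_play lab s v i.

Definition classW (out : vertex -> seq vertex)
    (lab : vertex -> label) (v : vertex) : Prop :=
  match lab v with
  | Trap => True
  | Target => False
  | Open => wins_game out lab v First
  end.

Definition classL (out : vertex -> seq vertex)
    (lab : vertex -> label) (v : vertex) : Prop :=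
  match lab v with
  | Trap => False
  | Target => True
  | Open => wins_game out lab v Second
  end.

Definition classD (out : vertex -> seq vertex)
    (lab : vertex -> label) (v : vertex) : Prop :=
  ~ classW out lab v /\ ~ classL out lab v.

Section RandomLabelling.
Context (R : realType) (d : measure_display) (T : measurableType d).
Variables (P : probability T R) (X : vertex -> T -> label).

Definition label_law (p q : R) (l : label) : R :=
  match l with Trap => p | Target => q | Open => 1 - p - q end.

Definition mutually_independent : Prop :=
  forall (s : seq vertex) (A : vertex -> set label), uniq s ->
    P (\bigcap_(v in [set` s]) (X v @^-1` A v)) =
    (\prod_(v <- s) P (X v @^-1` A v))%E.

(* [label] carries the discrete sigma-algebra. *)
Definition random_labelling (p q : R) : Prop :=
  [/\ forall (v : vertex) (A : set label), measurable (X v @^-1` A),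
      forall (v : vertex) (l : label),
        P (X v @^-1` [set l]) = (label_law p q l)%:E &
      mutually_independent].

Definition draw_event (out : vertex -> seq vertex) (v : vertex) :
    set T :=
  [set t | classD out (fun u => X u t) v].

End RandomLabelling.

Definition param_region (R : realType) : set (R * R) :=
  [set z | [/\ 0 <= z.1 <= 1, 0 <= z.2 <= 1 & 0 < z.1 + z.2 <= 1]].

(* Main.v *)
Require Import Defs.
From HB Require Import structures.
From mathcomp Require Import all_boot all_order all_algebra.
From mathcomp Require Import all_classical all_reals all_analysis.
From mathcomp Require Import ring lra zify.

(* In suitable coordinates each of the three games becomes the same one: from
   site [n] of level [t] the token moves to one of the sites [n], [n + 1],
   [n + 2] of level [t + 1].  The outcomes (win, loss, draw) of a level are then
   obtained from those of the next level by a one-dimensional probabilistic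
   cellular automaton, and we start it, [k] levels ahead, from draws only; a
   vertex is a draw iff it is still undecided for every [k].

   Let [N] stand for "not a loss", [delta m] for the probability that [m]
   consecutive sites are all [N] but not all wins, and [clusters] for the
   density of clusters of draws, where two draws are in different clusters as
   soon as a loss or three consecutive wins lie between them.  The function
   [Y (delta 3 + clusters) - Z delta 4], with [Y = 2 - p - p^2] and
   [Z = 1 - p - p^2], decreases at each step of the automaton by at least a
   constant multiple of the density of draws.  As it is bounded, this density
   tends to 0. *)

Set Implicit Arguments.
Unset Strict Implicit.
Unset Printing Implicit Defensive.

Import Order.TTheory GRing.Theory Num.Theory.

Local Open Scope classical_set_scope.
Local Open Scope ring_scope.

(** * The game and its finite-horizon values *)

Definition outcome := option bool.
Notation Win := (Some true).
Notation Lose := (Some false).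
Notation Draw := (@None bool).

Definition resolve (l : label) (cs : seq outcome) : outcome :=
  match l with
  | Trap => Win
  | Target => Lose
  | Open => if Lose \in cs then Win
            else if all (pred1 Win) cs then Lose else Draw
  end.

Section Game.
Variables (out : vertex -> seq vertex) (lab : vertex -> label).
Hypothesis out_neq0 : forall u, out u != [::].

(** Backward induction truncated after [k] levels, seen by the player about to move. The label of
    [v] itself is read with the convention of [classW] and [classL], so that moving to a trap hands
    the opponent a win. *)
Fixpoint value (k : nat) (v : vertex) : outcome :=
  if k is k'.+1 then resolve (lab v) [seq value k' u | u <- out v] else Draw.

Lemma value_open k u : lab u = Open -> value k.+1 u =
  if has (fun c => value k c == Lose) (out u) then Win
  else if all (fun c => value k c == Win) (out u) then Lose else Draw.
Proof.
move=> /= ->; rewrite /= all_map; congr (if _ then _ else _).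
by rewrite -has_pred1 has_map.
Qed.

Lemma value_incr k u b : value k u = Some b -> value k.+1 u = Some b.
Proof.
elim: k u b => // k IH u b; case E : (lab u); [by rewrite /= E..|].
rewrite !value_open //.
have stays b' c : value k c == Some b' -> value k.+1 c == Some b'.
  by move=> /eqP /IH ->.
case: hasP => [[c cu cL] [<-]|noL].
  by case: hasP => // -[]; exists c => //; apply: stays.
case: allP => // allW [<-]; case: hasP => [[c cu /eqP cL]|_].
  by have /stays := allW _ cu; rewrite cL.
by case: allP => // -[] c cu; apply/stays/allW.
Qed.

Lemma value_le k k' u b : (k <= k')%N -> value k u = Some b ->
  value k' u = Some b.
Proof.
move=> /subnK <-; elim: (_ - _)%N => // n IH /IH; rewrite addSn.
exact: value_incr.
Qed.

Lemma history_rcons s v n : exists h, history s v n = rcons h (token s v n).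
Proof.
case: n => [|n]; first by exists [::].
by exists (history s v n); rewrite /token /= last_rcons.
Qed.

Lemma tokenS s v n : token s v n.+1 = s (mover n.+1) (history s v n).
Proof. by rewrite /token /= last_rcons. Qed.

Lemma token_out s v n : legal out (s (mover n.+1)) ->
  token s v n.+1 \in out (token s v n).
Proof. by move=> sP; rewrite tokenS; have [h ->] := history_rcons s v n. Qed.

Lemma head_out u : head u (out u) \in out u.
Proof. by have := out_neq0 u; case: (out u) => //= a l _; rewrite mem_head. Qed.

(* The choice of the least horizon makes the horizon decrease along the play. *)
Definition win_move (u : vertex) : vertex :=
  if pselect (exists k, value k u == Win) is left ex then
    nth (head u (out u)) (out u)
      (find (fun c => value (ex_minn ex).-1 c == Lose) (out u))
  else head u (out u).

Lemma win_move_out u : win_move u \in out u.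
Proof.
rewrite /win_move; case: pselect => [ex|_]; last exact: head_out.
set i := find _ _; have [ilt|ige] := ltnP i (size (out u)).
  exact: mem_nth.
by rewrite nth_default //; apply: head_out.
Qed.

Lemma win_moveP k u : lab u = Open -> value k u = Win ->
  exists2 k', (k' < k)%N & value k' (win_move u) = Lose.
Proof.
move=> uO ukW; rewrite /win_move; case: pselect => [ex|[]]; last first.
  by exists k; apply/eqP.
case: ex_minnP => -[//|m] umW mmin; exists m.
  by apply: mmin; apply/eqP.
move: umW; rewrite /= -[resolve _ _]/(value m.+1 u) value_open //.
case: ifP => [hL _|_]; last by case: ifP.
by apply/eqP; exact: (nth_find (head u (out u)) hL).
Qed.

Lemma otherK i : other (other i) = i. Proof. by case: i. Qed.

Lemma moverS n : mover n.+1 = other (mover n).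
Proof. by rewrite /mover /=; case: (odd n). Qed.

Lemma mover_step i n : mover n.+1 = i -> mover n.+2 = other i.
Proof. by rewrite [mover n.+2]moverS => ->. Qed.

Lemma player_cases i j : j = i \/ j = other i.
Proof. by case: i j => -[]; [left|right|right|left]. Qed.

(** Strong induction on the horizon: the player who follows [win_move] faces a win or leaves a loss
    to the opponent, and the horizon shrinks at each move until a move ends the game. The mover from
    [token s v m] is [mover m.+1]. *)
Lemma value_wins_play (s : player -> strategy) v i k m :
  s i = (fun h => win_move (last v h)) -> legal out (s (other i)) ->
  (forall j, (0 < j <= m)%N -> lab (token s v j) = Open) ->
  lab (token s v m) = Open ->
  (mover m.+1 = i /\ value k (token s v m) = Win) \/
  (mover m.+1 = other i /\ value k (token s v m) = Lose) ->
  wins_play lab s v i.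
Proof.
move=> si sj; elim/ltn_ind: k m => k IH m before now.
have beforeS : lab (token s v m.+1) = Open ->
    forall j, (0 < j <= m.+1)%N -> lab (token s v j) = Open.
  move=> mO j /andP[j0]; rewrite leq_eqVlt => /predU1P[->//|jm].
  by apply: before; rewrite j0.
have ends : (mover m.+1 = i /\ lab (token s v m.+1) = Target) \/
    (mover m.+1 = other i /\ lab (token s v m.+1) = Trap) ->
    wins_play lab s v i.
  by move=> e; exists m.+1; split=> // j jm; apply: before.
case=> -[mi val].
  have [k' k'k] := win_moveP now val.
  have -> : win_move (token s v m) = token s v m.+1 by rewrite tokenS mi si.
  case E : (lab (token s v m.+1)) => val'; last 1 first.
  - apply: (IH k' k'k m.+1) => //; first exact: beforeS.
    by right; split=> //; apply: mover_step.
  - by case: k' {k'k} val' => //= k'; rewrite E.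
  - by apply: ends; left.
have c_out : token s v m.+1 \in out (token s v m).
  by apply: token_out; rewrite mi.
case: k IH val => // k IH; rewrite value_open //.
case: ifP => // _; case: allP => // allW _; have /eqP val' := allW _ c_out.
case E : (lab (token s v m.+1)); last 1 first.
- apply: (IH k (ltnSn k) m.+1) => //; first exact: beforeS.
  by left; split=> //; rewrite (mover_step mi) otherK.
- by apply: ends; right.
- by case: k {IH allW} val' => //= k; rewrite E.
Qed.

Lemma value_wins_game v i k : lab v = Open ->
  value k v = (if i is First then Win else Lose) -> wins_game out lab v i.
Proof.
move=> vO val; exists (fun h => win_move (last v h)); split.
  by move=> h u; rewrite last_rcons; apply: win_move_out.
move=> s si sj; apply: (@value_wins_play s v i k 0) => //.
  by move=> [|j]//=.
by case: i {si sj} val => val; [left|right].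
Qed.

(** * Vertices undecided at every horizon *)

Definition never (b : bool) (u : vertex) := forall k, value k u <> Some b.

(** A compactness argument: if every child were eventually a win, finiteness of [out u] and
    monotonicity of [value] in the horizon would give a common horizon, making [u] a loss. *)
Lemma never_lose_child u : lab u = Open -> never false u ->
  exists c, c \in out u /\ never true c.
Proof.
move=> uO nL; apply: contrapT => no; suff [K allW] :
    exists K, forall c, c \in out u -> value K c = Win.
  apply: (nL K.+1); rewrite value_open //; case: hasP => [[c /allW -> //]|_].
  by case: allP => // -[] c /allW ->.
have: forall c, c \in out u -> exists k, value k c = Win.
  move=> c cu; apply: contrapT => nk; apply: no; exists c; split=> // k kW.
  by apply: nk; exists k.
elim: (out u) => [|a l IH] h; first by exists 0%N.
have [|K HK] := IH; first by move=> c cl; apply: h; rewrite inE cl orbT.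
have [k Hk] := h a (mem_head _ _); exists (maxn k K) => c.
rewrite inE => /predU1P[->|/HK].
  exact: value_le (leq_maxl _ _) Hk.
exact/value_le/leq_maxr.
Qed.

Lemma never_win_child u c : lab u = Open -> never true u -> c \in out u ->
  never false c.
Proof.
move=> uO nW cu k kL; apply: (nW k.+1); rewrite value_open //.
by case: hasP => // -[]; exists c => //; rewrite kL.
Qed.

Definition safe_move (u : vertex) : vertex :=
  xget (head u (out u)) [set c | c \in out u /\ never true c].

Lemma safe_move_out u : safe_move u \in out u.
Proof.
by rewrite /safe_move; case: xgetP => [c _ []//|_]; apply: head_out.
Qed.

Lemma safe_moveP u : lab u = Open -> never false u -> never true (safe_move u).
Proof.
move=> uO /(never_lose_child uO) [c cP]; rewrite /safe_move.
by case: xgetP => [c' _ []//|/(_ c)].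
Qed.

(** Against a supposed winning strategy of [i], the opponent plays [safe_move]. Then the position is
    never a win when [i] is to move and never a loss when the opponent is, so [i] cannot reach a
    target nor the opponent a trap. *)
Lemma draw_not_wins_game v i : (forall k, value k v = Draw) ->
  ~ wins_game out lab v i.
Proof.
move=> vD [si [si_legal win]].
pose sj : strategy := fun h => safe_move (last v h).
pose s j := if `[< j = i >] then si else sj.
have s_i : s i = si by rewrite /s; case: asboolP.
have s_j : s (other i) = sj.
  by rewrite /s; case: asboolP => //; case: (i).
have [|n [n0 before last_move]] := win s s_i.
  by rewrite s_j => h u; rewrite /sj last_rcons; apply: safe_move_out.
have notTrap u : never true u -> lab u <> Trap.
  by move=> nW uT; apply: (nW 1%N); rewrite /= uT.
have notTarget u : never false u -> lab u <> Target.
  by move=> nL uT; apply: (nL 1%N); rewrite /= uT.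
have vO : lab v = Open.
  by have := vD 1%N; rewrite /=; case: (lab v).
have step m : lab (token s v m) = Open ->
    (mover m.+1 = i /\ never true (token s v m)) \/
    (mover m.+1 = other i /\ never false (token s v m)) ->
    (mover m.+1 = i /\ never false (token s v m.+1)) \/
    (mover m.+1 = other i /\ never true (token s v m.+1)).
  move=> mO [[mi nW]|[mi nL]]; [left|right]; split=> //.
    by apply: never_win_child nW _ => //; apply: token_out; rewrite mi s_i.
  by rewrite tokenS mi s_j; apply: safe_moveP.
have main m : (m < n)%N -> (mover m.+1 = i /\ never true (token s v m)) \/
    (mover m.+1 = other i /\ never false (token s v m)).
  elim: m => [_|m IH mn].
    have nv b : never b v by move=> k; rewrite vD.
    by case: (player_cases i (mover 1)) => ->; [left|right].
  have mO : lab (token s v m) = Open.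
    by case: m {IH} mn => // m mn; apply: before; rewrite /= ltnW.
  case: (step m mO (IH (ltnW mn))) => -[mi nb]; [right|left]; split=> //.
    exact: mover_step.
  by rewrite (mover_step mi) otherK.
case: n n0 before last_move main => // n _ before last_move main.
have nO : lab (token s v n) = Open.
  by case: n before {last_move main} => // n before; apply: before => /=.
have ineq : i <> other i by case: (i).
case: (step n nO (main n (ltnSn n))) => -[mi nb];
  case: last_move => -[mi' lb].
- exact: notTarget lb.
- by apply: ineq; rewrite -mi'.
- by apply: ineq; rewrite -mi.
- exact: notTrap lb.
Qed.

(** Replaces strategies by countably many conditions, each on finitely many labels. *)
Lemma classDE v : classD out lab v <-> forall k, value k v = Draw.
Proof.
split=> [[nW nL] k|vD].
  case E : (lab v); first by case: nW; rewrite /classW E.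
    by case: nL; rewrite /classL E.
  case V : (value k v) => [[]|] //; [case: nW|case: nL].
    by rewrite /classW E; apply: (@value_wins_game v First k).
  by rewrite /classL E; apply: (@value_wins_game v Second k).
rewrite /classD /classW /classL; have := vD 1%N => /=.
by case: (lab v) => // _; split; apply: draw_not_wins_game.
Qed.

End Game.

(** * Coefficients of the loss *)

Section Coefficients.
Variables (R : realType) (p q : R).
Let r := 1 - p - q.
Let s := 1 - q.

(* For [q = 0] and small [p] the ratio [Zc / Yc] is forced to lie in an
   interval of length [O(p^3)]; this choice works for all [p] and [q]. *)
Definition Yc : R := 2 - p - p ^+ 2.
Definition Zc : R := 1 - p - p ^+ 2.
Local Notation Y := Yc.
Local Notation Z := Zc.

(* [c3], ..., [c6] are the coefficients of [delta 3], ..., [delta 6] in the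
   loss of the Lyapunov function during one step, and [S3], [S4], [S5] are the
   partial sums of the coefficients of [flank 3], [flank 4], [flank 5]. *)
Definition c3 : R := Y * (1 - r - 3 * s ^+ 2 * r) + 4 * Z * s ^+ 3 * r.
Definition c4 : R := Y * r ^+ 2 * (1 + 2 * s) - Z * (1 + 3 * s ^+ 2 * r ^+ 2).
Definition c5 : R := 2 * p * r ^+ 2 * (Y - s * Z).
Definition c6 : R := p ^+ 2 * r ^+ 2 * (Y - Z).
Definition S3 : R := Y - c3 - 2 * Y * r ^+ 2 * (1 + p + p ^+ 2).
Definition S4 : R := S3 + c5 + c6 - 2 * Y * r ^+ 2 * (p + p ^+ 2).
Definition S5 : R := S4 + c6 - 2 * Y * r ^+ 2 * p ^+ 2.

Hypotheses (p0 : 0 <= p) (q0 : 0 <= q) (r0 : 0 <= r).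

(* The signs below come from expanding in [p], [q], [r], homogenized to degree 6
   by means of [p + q + r = 1]: all the coefficients are then nonnegative. *)
Local Ltac expand :=
  rewrite /S5 /S4 /S3 /c6 /c5 /c4 /c3 /Yc /Zc /s /r; ring.
Local Ltac monomials :=
  repeat first [assumption | exact: ler0n | apply: addr_ge0 | apply: mulr_ge0
    | apply: exprn_ge0].

Lemma Yc_ge0 : 0 <= Y.
Proof.
have -> : Y = (q + r) * (2 + p) by rewrite /Yc /r; ring.
monomials.
Qed.

Lemma c6_ge0 : 0 <= c6.
Proof.
have -> : c6 = p ^+ 2 * r ^+ 2 by rewrite /c6 /Yc /Zc; ring.
monomials.
Qed.

Lemma c5_ge0 : 0 <= c5.
Proof.
have -> : c5 =
    2 * p ^+ 4 * r ^+ 2 + 4 * p ^+ 3 * q * r ^+ 2 + 6 * p ^+ 3 * r ^+ 3 +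
    8 * p ^+ 2 * q ^+ 2 * r ^+ 2 + 14 * p ^+ 2 * q * r ^+ 3 +
    6 * p ^+ 2 * r ^+ 4 + 4 * p * q ^+ 3 * r ^+ 2 + 10 * p * q ^+ 2 * r ^+ 3 +
    8 * p * q * r ^+ 4 + 2 * p * r ^+ 5.
  expand.
monomials.
Qed.

Lemma S3_ge0 : 0 <= S3.
Proof.
have -> : S3 =
    4 * p ^+ 5 * r + 8 * p ^+ 4 * q * r + 20 * p ^+ 4 * r ^+ 2 +
    22 * p ^+ 3 * q ^+ 2 * r + 32 * p ^+ 3 * q * r ^+ 2 +
    22 * p ^+ 3 * r ^+ 3 + 21 * p ^+ 2 * q ^+ 3 * r +
    51 * p ^+ 2 * q ^+ 2 * r ^+ 2 + 36 * p ^+ 2 * q * r ^+ 3 +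
    10 * p ^+ 2 * r ^+ 4 + 9 * p * q ^+ 4 * r + 30 * p * q ^+ 3 * r ^+ 2 +
    39 * p * q ^+ 2 * r ^+ 3 + 20 * p * q * r ^+ 4 + 2 * p * r ^+ 5 +
    2 * q ^+ 5 * r + 6 * q ^+ 4 * r ^+ 2 + 10 * q ^+ 3 * r ^+ 3 +
    10 * q ^+ 2 * r ^+ 4 + 4 * q * r ^+ 5.
  expand.
monomials.
Qed.

Lemma S4_ge0 : 0 <= S4.
Proof.
have -> : S4 =
    4 * p ^+ 5 * r + 8 * p ^+ 4 * q * r + 23 * p ^+ 4 * r ^+ 2 +
    22 * p ^+ 3 * q ^+ 2 * r + 26 * p ^+ 3 * q * r ^+ 2 +
    18 * p ^+ 3 * r ^+ 3 + 21 * p ^+ 2 * q ^+ 3 * r +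
    46 * p ^+ 2 * q ^+ 2 * r ^+ 2 + 24 * p ^+ 2 * q * r ^+ 3 +
    3 * p ^+ 2 * r ^+ 4 + 9 * p * q ^+ 4 * r + 30 * p * q ^+ 3 * r ^+ 2 +
    37 * p * q ^+ 2 * r ^+ 3 + 16 * p * q * r ^+ 4 + 2 * q ^+ 5 * r +
    6 * q ^+ 4 * r ^+ 2 + 10 * q ^+ 3 * r ^+ 3 + 10 * q ^+ 2 * r ^+ 4 +
    4 * q * r ^+ 5.
  expand.
monomials.
Qed.

Lemma S5_ge0 : 0 <= S5.
Proof.
have -> : S5 =
    4 * p ^+ 5 * r + 8 * p ^+ 4 * q * r + 24 * p ^+ 4 * r ^+ 2 +
    22 * p ^+ 3 * q ^+ 2 * r + 22 * p ^+ 3 * q * r ^+ 2 +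
    14 * p ^+ 3 * r ^+ 3 + 21 * p ^+ 2 * q ^+ 3 * r +
    43 * p ^+ 2 * q ^+ 2 * r ^+ 2 + 18 * p ^+ 2 * q * r ^+ 3 +
    9 * p * q ^+ 4 * r + 30 * p * q ^+ 3 * r ^+ 2 + 37 * p * q ^+ 2 * r ^+ 3 +
    16 * p * q * r ^+ 4 + 2 * q ^+ 5 * r + 6 * q ^+ 4 * r ^+ 2 +
    10 * q ^+ 3 * r ^+ 3 + 10 * q ^+ 2 * r ^+ 4 + 4 * q * r ^+ 5.
  expand.
monomials.
Qed.

(** The coefficient of [edge k 3] left in the loss: [S3] from the flanks, minus the cost of bounding
    [entry k 4] and [entry k 5]. *)
Lemma S3_sub_ge0 : 0 <= S3 - c5 - 2 * c6.
Proof.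
have -> : S3 - c5 - 2 * c6 =
    4 * p ^+ 5 * r + 8 * p ^+ 4 * q * r + 16 * p ^+ 4 * r ^+ 2 +
    22 * p ^+ 3 * q ^+ 2 * r + 24 * p ^+ 3 * q * r ^+ 2 +
    12 * p ^+ 3 * r ^+ 3 + 21 * p ^+ 2 * q ^+ 3 * r +
    41 * p ^+ 2 * q ^+ 2 * r ^+ 2 + 18 * p ^+ 2 * q * r ^+ 3 +
    2 * p ^+ 2 * r ^+ 4 + 9 * p * q ^+ 4 * r + 26 * p * q ^+ 3 * r ^+ 2 +
    29 * p * q ^+ 2 * r ^+ 3 + 12 * p * q * r ^+ 4 + 2 * q ^+ 5 * r +
    6 * q ^+ 4 * r ^+ 2 + 10 * q ^+ 3 * r ^+ 3 + 10 * q ^+ 2 * r ^+ 4 +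
    4 * q * r ^+ 5.
  expand.
monomials.
Qed.

(** The same for [edge k 4], which occurs in the bound on [entry k 5] only. *)
Lemma S4_sub_ge0 : 0 <= S4 - c6.
Proof.
have -> : S4 - c6 =
    4 * p ^+ 5 * r + 8 * p ^+ 4 * q * r + 22 * p ^+ 4 * r ^+ 2 +
    22 * p ^+ 3 * q ^+ 2 * r + 24 * p ^+ 3 * q * r ^+ 2 +
    16 * p ^+ 3 * r ^+ 3 + 21 * p ^+ 2 * q ^+ 3 * r +
    45 * p ^+ 2 * q ^+ 2 * r ^+ 2 + 22 * p ^+ 2 * q * r ^+ 3 +
    2 * p ^+ 2 * r ^+ 4 + 9 * p * q ^+ 4 * r + 30 * p * q ^+ 3 * r ^+ 2 +
    37 * p * q ^+ 2 * r ^+ 3 + 16 * p * q * r ^+ 4 + 2 * q ^+ 5 * r +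
    6 * q ^+ 4 * r ^+ 2 + 10 * q ^+ 3 * r ^+ 3 + 10 * q ^+ 2 * r ^+ 4 +
    4 * q * r ^+ 5.
  expand.
monomials.
Qed.

(** The coefficient of [delta k 4] in the loss. The terms isolated in front vanish only when [p] and
    [q] both do. *)
Lemma sigma_gt0 : 0 < p + q -> 0 < c3 + c4 + c5 + c6.
Proof.
have -> : c3 + c4 + c5 + c6 = (p ^+ 6 + q ^+ 6) + (
    6 * p ^+ 5 * q + 2 * p ^+ 5 * r + 15 * p ^+ 4 * q ^+ 2 +
    22 * p ^+ 4 * q * r + p ^+ 4 * r ^+ 2 + 20 * p ^+ 3 * q ^+ 3 +
    38 * p ^+ 3 * q ^+ 2 * r + 22 * p ^+ 3 * q * r ^+ 2 +
    15 * p ^+ 2 * q ^+ 4 + 39 * p ^+ 2 * q ^+ 3 * r +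
    33 * p ^+ 2 * q ^+ 2 * r ^+ 2 + 10 * p ^+ 2 * q * r ^+ 3 +
    6 * p * q ^+ 5 + 21 * p * q ^+ 4 * r + 27 * p * q ^+ 3 * r ^+ 2 +
    14 * p * q ^+ 2 * r ^+ 3 + 2 * p * q * r ^+ 4 + 4 * q ^+ 5 * r +
    7 * q ^+ 4 * r ^+ 2 + 6 * q ^+ 3 * r ^+ 3 + 2 * q ^+ 2 * r ^+ 4).
  expand.
move=> pq0; apply: ltr_wpDr; first monomials.
have [pE|pn0] := eqVneq p 0; last first.
  by rewrite ltr_pwDl ?exprn_ge0 ?exprn_gt0 // lt0r pn0.
by move: pq0; rewrite pE !add0r expr0n add0r => ?; apply: exprn_gt0.
Qed.

(** The coefficient of [lambda k] in the loss when [c3] is nonnegative. *)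
Lemma lambda1_gt0 : 0 < r -> 0 < Y - c5 - 2 * c6.
Proof.
have -> : Y - c5 - 2 * c6 = 2 * r ^+ 6 + (
    3 * p ^+ 5 * q + 3 * p ^+ 5 * r + 14 * p ^+ 4 * q ^+ 2 +
    28 * p ^+ 4 * q * r + 10 * p ^+ 4 * r ^+ 2 + 26 * p ^+ 3 * q ^+ 3 +
    78 * p ^+ 3 * q ^+ 2 * r + 70 * p ^+ 3 * q * r ^+ 2 +
    16 * p ^+ 3 * r ^+ 3 + 24 * p ^+ 2 * q ^+ 4 + 96 * p ^+ 2 * q ^+ 3 * r +
    134 * p ^+ 2 * q ^+ 2 * r ^+ 2 + 78 * p ^+ 2 * q * r ^+ 3 +
    16 * p ^+ 2 * r ^+ 4 + 11 * p * q ^+ 5 + 55 * p * q ^+ 4 * r +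
    106 * p * q ^+ 3 * r ^+ 2 + 100 * p * q ^+ 2 * r ^+ 3 +
    47 * p * q * r ^+ 4 + 9 * p * r ^+ 5 + 2 * q ^+ 6 + 12 * q ^+ 5 * r +
    30 * q ^+ 4 * r ^+ 2 + 40 * q ^+ 3 * r ^+ 3 + 30 * q ^+ 2 * r ^+ 4 +
    12 * q * r ^+ 5).
  expand.
move=> r_gt0; apply: ltr_wpDr; first monomials.
by rewrite mulr_gt0 ?exprn_gt0.
Qed.

(** The coefficient of [lambda k] when [c3] is negative, [entry k 3] being then bounded by
    [lambda k]. *)
Lemma lambda2_gt0 : 0 < r -> 0 < p + q -> 0 < Y + c3 - c5 - 2 * c6.
Proof.
have -> : Y + c3 - c5 - 2 * c6 = (2 * p ^+ 5 * r + 4 * q ^+ 6) + (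
    6 * p ^+ 5 * q + 28 * p ^+ 4 * q ^+ 2 + 48 * p ^+ 4 * q * r +
    4 * p ^+ 4 * r ^+ 2 + 52 * p ^+ 3 * q ^+ 3 + 134 * p ^+ 3 * q ^+ 2 * r +
    98 * p ^+ 3 * q * r ^+ 2 + 2 * p ^+ 3 * r ^+ 3 + 48 * p ^+ 2 * q ^+ 4 +
    171 * p ^+ 2 * q ^+ 3 * r + 197 * p ^+ 2 * q ^+ 2 * r ^+ 2 +
    78 * p ^+ 2 * q * r ^+ 3 + 22 * p * q ^+ 5 + 101 * p * q ^+ 4 * r +
    168 * p * q ^+ 3 * r ^+ 2 + 117 * p * q ^+ 2 * r ^+ 3 +
    28 * p * q * r ^+ 4 + 22 * q ^+ 5 * r + 50 * q ^+ 4 * r ^+ 2 +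
    54 * q ^+ 3 * r ^+ 3 + 26 * q ^+ 2 * r ^+ 4 + 4 * q * r ^+ 5).
  expand.
move=> r_gt0 pq0; apply: ltr_wpDr; first monomials.
have [pE|pn0] := eqVneq p 0; last first.
  have p_gt0 : 0 < p by rewrite lt0r pn0.
  by rewrite ltr_pwDl ?mulr_ge0 ?mulr_gt0 ?exprn_ge0 ?exprn_gt0.
move: pq0; rewrite pE !add0r expr0n mulr0 mul0r add0r => q_gt0.
by rewrite mulr_gt0 ?exprn_gt0.
Qed.

End Coefficients.

(** * The law of a level *)

(** A site looks at three sites of the next level, so a window loses two sites per step; hence the
    recurring condition [size u = (size ls).+2]. *)
Fixpoint step (ls : seq label) (u : seq outcome) : seq outcome :=
  match ls, u with
  | l :: ls', a :: (b :: c :: _) as u' => resolve l [:: a; b; c] :: step ls' u'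
  | _, _ => [::]
  end.

Lemma size_step ls u : size u = (size ls).+2 -> size (step ls u) = size ls.
Proof.
elim: ls u => [|l ls IH] [|a [|b [|c u]]] //= [su].
by rewrite IH //= su.
Qed.

Lemma behead_step ls u : size u = (size ls).+2 ->
  behead (step ls u) = step (behead ls) (behead u).
Proof. by case: ls u => [|l ls] [|a [|b [|c u]]]. Qed.

Lemma nth_step ls u i : size u = (size ls).+2 -> (i < size ls)%N ->
  nth Draw (step ls u) i = resolve (nth Open ls i)
    [:: nth Draw u i; nth Draw u i.+1; nth Draw u i.+2].
Proof.
elim: ls u i => [|l ls IH] [|a [|b [|c u]]] //= [|i] //= [su] il.
by rewrite IH //= su.
Qed.

Lemma resolve_rev l cs : resolve l (rev cs) = resolve l cs.
Proof. by case: l; rewrite //= mem_rev all_rev. Qed.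

Lemma rev_step ls u : size u = (size ls).+2 ->
  rev (step ls u) = step (rev ls) (rev u).
Proof.
move=> su; have sr : size (rev u) = (size (rev ls)).+2 by rewrite !size_rev.
apply: (@eq_from_nth _ Draw) => [|i]; rewrite size_rev size_step //.
  by rewrite size_step // size_rev.
move=> il; set j := (size ls - i.+1)%N.
have jl : (j < size ls)%N by rewrite /j; lia.
rewrite nth_rev ?size_step // -/j nth_step // nth_step ?size_rev //.
rewrite !nth_rev ?su ?ltnS // 1?ltnW // 1?ltnW // -/j -[LHS]resolve_rev.
have -> : ((size ls).+2 - i.+1)%N = j.+2 by rewrite /j; lia.
have -> : ((size ls).+2 - i.+2)%N = j.+1 by rewrite /j; lia.
by have -> : ((size ls).+2 - i.+3)%N = j by rewrite /j; lia.
Qed.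

Section Law.
Variables (R : realType) (p q : R).
Let r := 1 - p - q.

Fixpoint avg (n : nat) (g : seq label -> R) : R :=
  if n is m.+1 then
    p * avg m (fun ls => g (Trap :: ls)) +
    q * avg m (fun ls => g (Target :: ls)) +
    r * avg m (fun ls => g (Open :: ls))
  else g [::].

Lemma eq_avg n g h : (forall ls, size ls = n -> g ls = h ls) ->
  avg n g = avg n h.
Proof.
elim: n g h => [|n IH] g h gh /=; first exact: gh.
by do 2?congr (_ + _); congr (_ * _); apply: IH => ls sl; apply: gh;
  rewrite /= sl.
Qed.

Lemma avg_linear n a g h :
  avg n (fun ls => a * g ls + h ls) = a * avg n g + avg n h.
Proof. by elim: n g h => //= n IH g h; rewrite !IH; ring. Qed.

Lemma avg_cst n a : avg n (fun=> a) = a.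
Proof. by elim: n => //= n ->; rewrite /r; ring. Qed.

Lemma avg_behead n g : avg n.+1 (fun ls => g (behead ls)) = avg n g.
Proof.
rewrite -[LHS]/(p * avg n g + q * avg n g + r * avg n g) /r; ring.
Qed.

Lemma avg_rcons n g : avg n.+1 g =
    p * avg n (fun ls => g (rcons ls Trap)) +
    q * avg n (fun ls => g (rcons ls Target)) +
    r * avg n (fun ls => g (rcons ls Open)).
Proof.
elim: n g => // n IH g.
have E l := IH (fun ls => g (l :: ls)).
rewrite -[LHS]/(p * avg n.+1 (fun ls => g (Trap :: ls)) +
  q * avg n.+1 (fun ls => g (Target :: ls)) +
  r * avg n.+1 (fun ls => g (Open :: ls))) (E Trap) (E Target) (E Open) /=.
ring.
Qed.

Lemma avg_rev n g : avg n (fun ls => g (rev ls)) = avg n g.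
Proof.
elim: n g => // n IH g; rewrite avg_rcons /=.
by do 2?congr (_ + _); congr (_ * _); rewrite -[RHS]IH; apply: eq_avg => ls _;
  rewrite rev_rcons.
Qed.

Hypotheses (p0 : 0 <= p) (q0 : 0 <= q) (r0 : 0 <= r).

Lemma avg_ge0 n g : (forall ls, 0 <= g ls) -> 0 <= avg n g.
Proof. by elim: n g => //= n IH g g0; rewrite !addr_ge0 ?mulr_ge0 ?IH. Qed.

(** Expectation of [f] on [n] consecutive sites after [k] steps from draws only. The recursion peels
    off the last step, so the window grows by two sites as one goes back in time. *)
Fixpoint expect (k n : nat) (f : seq outcome -> R) : R :=
  if k is k'.+1 then
    expect k' n.+2 (fun u => avg n (fun ls => f (step ls u)))
  else f (nseq n Draw).

Lemma eq_expect k n f g : (forall u, size u = n -> f u = g u) ->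
  expect k n f = expect k n g.
Proof.
elim: k n f g => [|k IH] n f g fg /=; first by rewrite fg ?size_nseq.
by apply: IH => u su; apply: eq_avg => ls sl; apply: fg; rewrite size_step ?sl.
Qed.

Lemma expect_linear k n a f g :
  expect k n (fun u => a * f u + g u) = a * expect k n f + expect k n g.
Proof.
elim: k n f g => //= k IH n f g; rewrite -IH.
by apply: eq_expect => u _; rewrite avg_linear.
Qed.

Lemma expect_cst k n a : expect k n (fun=> a) = a.
Proof.
elim: k n => //= k IH n; rewrite -[RHS](IH n.+2).
by apply: eq_expect => u _; rewrite avg_cst.
Qed.

Lemma expect_avg k n m f : expect k n (fun u => avg m (fun ls => f ls u)) =
  avg m (fun ls => expect k n (f ls)).
Proof.
elim: m f => //= m IH f; rewrite -!IH -!addrA -[r * _]addr0.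
rewrite -[X in r * _ + X](expect_cst k n) -!expect_linear.
by apply: eq_expect => u _; rewrite addr0 addrA.
Qed.

Lemma expect_ge0 k n f : (forall u, 0 <= f u) -> 0 <= expect k n f.
Proof. by elim: k n f => //= k IH n f f0; apply: IH => u; apply: avg_ge0. Qed.

Lemma expect_behead k n f :
  expect k n.+1 (fun u => f (behead u)) = expect k n f.
Proof.
elim: k n f => //= k IH n f; rewrite -[RHS]IH; apply: eq_expect => u su.
rewrite -[LHS]/(avg n.+1 (fun ls => f (behead (step ls u)))).
rewrite -[RHS]/(avg n (fun ls => f (step ls (behead u)))) -[RHS]avg_behead.
by apply: eq_avg => ls sl; rewrite behead_step // sl.
Qed.

Lemma expect_rev k n f : expect k n (fun u => f (rev u)) = expect k n f.
Proof.
elim: k n f => [|k IH] n f /=; first by rewrite rev_nseq.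
rewrite -[RHS]IH; apply: eq_expect => u su; rewrite /= -[RHS]avg_rev.
by apply: eq_avg => ls sl; rewrite rev_step ?sl.
Qed.

(** * Probabilities of words of outcomes *)

Inductive letter := pW | pL | pD | pN | pT.

Definition matches (a : letter) (o : outcome) : bool :=
  match a with
  | pW => o == Win | pL => o == Lose | pD => o == Draw
  | pN => o != Lose | pT => true
  end.

Definition ind (s : seq letter) (u : seq outcome) : R := (all2 matches s u)%:R.

Definition pr (k : nat) (s : seq letter) : R := expect k (size s) (ind s).

Lemma pr_ge0 k s : 0 <= pr k s.
Proof. by apply: expect_ge0 => u; rewrite ler0n. Qed.

Lemma all2_rev (A B : Type) (e : A -> B -> bool) s t : size s = size t ->
  all2 e (rev s) (rev t) = all2 e s t.
Proof.
have all2_rcons l m a b : size l = size m ->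
    all2 e (rcons l a) (rcons m b) = all2 e l m && e a b.
  elim: l m => [|x l IH] [|y m] //=; first by rewrite andbT.
  by move=> [lm]; rewrite IH // andbA.
elim: s t => [|a s IH] [|b t] //= [st].
by rewrite !rev_cons all2_rcons ?size_rev // IH // andbC.
Qed.

Lemma pr_rev k s : pr k (rev s) = pr k s.
Proof.
rewrite /pr size_rev -[LHS]expect_rev; apply: eq_expect => u su.
by rewrite /ind all2_rev.
Qed.

Lemma pr_T k s : pr k (pT :: s) = pr k s.
Proof.
by rewrite /pr -[RHS]expect_behead; apply: eq_expect => -[|o u].
Qed.

Lemma pr_split k s1 s2 a b c :
  (forall o, (matches a o)%:R = (matches b o)%:R + (matches c o)%:R :> R) ->
  pr k (s1 ++ a :: s2) = pr k (s1 ++ b :: s2) + pr k (s1 ++ c :: s2).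
Proof.
move=> abc; rewrite /pr !size_cat /= -[X in X + _]mul1r -expect_linear.
apply: eq_expect => u _; rewrite mul1r /ind.
elim: s1 u => [|x s1 IH] [|o u] /=; rewrite ?addr0 //.
  by rewrite -!mulnb !natrM abc mulrDl.
by case: (matches x o) => //=; rewrite addr0.
Qed.

Lemma pr_N k s1 s2 :
  pr k (s1 ++ pN :: s2) = pr k (s1 ++ pW :: s2) + pr k (s1 ++ pD :: s2).
Proof. by apply: pr_split => -[[]|] /=; rewrite ?addr0 ?add0r. Qed.

Lemma pr_LN k s1 s2 :
  pr k (s1 ++ pT :: s2) = pr k (s1 ++ pL :: s2) + pr k (s1 ++ pN :: s2).
Proof. by apply: pr_split => -[[]|] /=; rewrite ?addr0 ?add0r. Qed.

Definition site_prob (a : letter) (x y z : outcome) : R :=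
  p * (matches a Win)%:R + q * (matches a Lose)%:R +
  r * (matches a (resolve Open [:: x; y; z]))%:R.

(** Given the next level, the sites of a level are independent, whence a product of the conditional
    probabilities [site_prob]. *)
Fixpoint word_prob (s : seq letter) (u : seq outcome) : R :=
  match s, u with
  | a :: s', x :: (y :: z :: _) as u' => site_prob a x y z * word_prob s' u'
  | _, _ => 1
  end.

Lemma avg_word s u : size u = (size s).+2 ->
  avg (size s) (fun ls => ind s (step ls u)) = word_prob s u.
Proof.
elim: s u => [|a s IH] [|x [|y [|z u]]] // [su].
pose F l ls := ind (a :: s) (step (l :: ls) [:: x, y, z & u]).
have E l : avg (size s) (F l) =
    (matches a (resolve l [:: x; y; z]))%:R * word_prob s [:: y, z & u].
  rewrite -IH /= ?su // -[RHS]addr0 -[X in _ + X](avg_cst (size s)) -avg_linear.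
  by apply: eq_avg => ls _; rewrite addr0 /F /ind -mulnb natrM.
rewrite -[LHS]/(p * avg (size s) (F Trap) + q * avg (size s) (F Target) +
  r * avg (size s) (F Open)).
by rewrite !E /= /site_prob; ring.
Qed.

(** Turns a pointwise identity on a finite window, provable by cases, into a linear recursion
    between word probabilities. *)
Lemma pr_step k s (cs : seq (R * seq letter)) :
  all (fun c => size c.2 == (size s).+2) cs ->
  (forall u, size u = (size s).+2 ->
     word_prob s u = \sum_(c <- cs) c.1 * ind c.2 u) ->
  pr k.+1 s = \sum_(c <- cs) c.1 * pr k c.2.
Proof.
move=> size_cs E; rewrite /pr /=.
under eq_expect => u su do rewrite avg_word // E //.
elim: cs size_cs {E} => [_|c cs IH /= /andP[/eqP sc /IH E]].
  rewrite big_nil; under eq_expect => u _ do rewrite big_nil.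
  exact: expect_cst.
rewrite big_cons -E sc -expect_linear.
by apply: eq_expect => u _; rewrite big_cons.
Qed.

Lemma pr_nil k : pr k [::] = 1.
Proof.
by rewrite /pr (@eq_expect _ _ _ (fun=> 1)) ?expect_cst // => -[].
Qed.

Definition pad (i : nat) (s : seq letter) (j : nat) : seq letter :=
  nseq i pT ++ s ++ nseq j pT.

Lemma pr_pad k i s j : pr k (pad i s j) = pr k s.
Proof.
rewrite /pad; elim: i => [|i IH] /=; last by rewrite pr_T.
rewrite -pr_rev rev_cat rev_nseq -[RHS]pr_rev.
by elim: j => //= j IH; rewrite pr_T.
Qed.

(* Win and "not a loss" play symmetric roles in the automaton. *)
Definition dual (a b : letter) : Prop := forall x y z, site_prob b x y z =
  (1 - q) - r * ((matches a x)%:R * (matches a y)%:R * (matches a z)%:R).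

Lemma dualWN : dual pW pN.
Proof. by move=> [[]|] [[]|] [[]|]; rewrite /site_prob /= /r; ring. Qed.

Lemma dualNW : dual pN pW.
Proof. by move=> [[]|] [[]|] [[]|]; rewrite /site_prob /= /r; ring. Qed.

Lemma site_D x y z : site_prob pD x y z = r *
  ((matches pN x)%:R * (matches pN y)%:R * (matches pN z)%:R -
   (matches pW x)%:R * (matches pW y)%:R * (matches pW z)%:R).
Proof. by move: x y z => [[]|] [[]|] [[]|]; rewrite /site_prob /= /r; ring. Qed.

Local Notation run k m a := (pr k (nseq m a)).

(** By [dual], the word is a product of three factors [(1 - q) - r * A], with [A] the indicator of
    three consecutive [a]. Overlapping blocks merge into longer runs. The outer two already cover
    the middle one, whence the coefficient [(1 - q) * r ^+ 2 - r ^+ 3 = p * r ^+ 2] of the run of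
    length 5. *)
Lemma pr_step3 a b k : dual a b -> run k.+1 3 b =
  (1 - q) ^+ 3 - 3 * (1 - q) ^+ 2 * r * run k 3 a
  + 2 * (1 - q) * r ^+ 2 * run k 4 a + p * r ^+ 2 * run k 5 a.
Proof.
move=> ab.
rewrite (@pr_step k (nseq 3 b) [:: ((1 - q) ^+ 3, pad 5 [::] 0);
  (- ((1 - q) ^+ 2 * r), pad 0 (nseq 3 a) 2);
  (- ((1 - q) ^+ 2 * r), pad 1 (nseq 3 a) 1);
  (- ((1 - q) ^+ 2 * r), pad 2 (nseq 3 a) 0);
  ((1 - q) * r ^+ 2, pad 0 (nseq 4 a) 1);
  ((1 - q) * r ^+ 2, pad 1 (nseq 4 a) 0);
  (p * r ^+ 2, pad 0 (nseq 5 a) 0)]) //.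
  by rewrite !big_cons big_nil /= !pr_pad pr_nil; ring.
move=> [|x0 [|x1 [|x2 [|x3 [|x4 [|//]]]]]] // _.
rewrite !big_cons big_nil /ind /= !ab.
case: (matches a x0); case: (matches a x1); case: (matches a x2);
  case: (matches a x3); case: (matches a x4); rewrite /= /r; ring.
Qed.

Lemma pr_step4 a b k : dual a b -> run k.+1 4 b =
  (1 - q) ^+ 4 - 4 * (1 - q) ^+ 3 * r * run k 3 a
  + 3 * (1 - q) ^+ 2 * r ^+ 2 * run k 4 a
  + 2 * (1 - q) * p * r ^+ 2 * run k 5 a + p ^+ 2 * r ^+ 2 * run k 6 a.
Proof.
move=> ab; set s := 1 - q.
rewrite (@pr_step k (nseq 4 b) [:: (s ^+ 4, pad 6 [::] 0);
  (- (s ^+ 3 * r), pad 0 (nseq 3 a) 3); (- (s ^+ 3 * r), pad 1 (nseq 3 a) 2);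
  (- (s ^+ 3 * r), pad 2 (nseq 3 a) 1); (- (s ^+ 3 * r), pad 3 (nseq 3 a) 0);
  (s ^+ 2 * r ^+ 2, pad 0 (nseq 4 a) 2); (s ^+ 2 * r ^+ 2, pad 1 (nseq 4 a) 1);
  (s ^+ 2 * r ^+ 2, pad 2 (nseq 4 a) 0);
  (s * p * r ^+ 2, pad 0 (nseq 5 a) 1); (s * p * r ^+ 2, pad 1 (nseq 5 a) 0);
  (p ^+ 2 * r ^+ 2, pad 0 (nseq 6 a) 0)]) //.
  by rewrite !big_cons big_nil /= !pr_pad pr_nil; ring.
move=> [|x0 [|x1 [|x2 [|x3 [|x4 [|x5 [|//]]]]]]] // _.
rewrite !big_cons big_nil /ind /= !ab /s.
case: (matches a x0); case: (matches a x1); case: (matches a x2);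
  case: (matches a x3); case: (matches a x4); case: (matches a x5);
  rewrite /= /r; ring.
Qed.

Lemma pr_step_D k : pr k.+1 [:: pD] = r * (run k 3 pN - run k 3 pW).
Proof.
rewrite (@pr_step k [:: pD] [:: (r, nseq 3 pN); (- r, nseq 3 pW)]) //.
  by rewrite !big_cons big_nil /=; ring.
move=> [|x0 [|x1 [|x2 [|//]]]] // _.
rewrite !big_cons big_nil /ind /= !site_D.
by move: x0 x1 x2 => [[]|] [[]|] [[]|] /=; ring.
Qed.

(** Keeping the win indicator [w] of a non-losing site symbolic lets [ring] treat a win and a draw
    as one case. *)
Variant NW_spec : R -> R -> Prop :=
  | NW_not_lose (w : bool) : NW_spec 1 w%:R
  | NW_lose : NW_spec 0 0.

Lemma NWP x : NW_spec (x != Lose)%:R (x == Win)%:R.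
Proof. by case: x => [[]|]; constructor. Qed.

(* Between two draws without a loss, a win comes from a trap. *)
Lemma pr_step_DD k (m : nat) : (0 < m < 4)%N ->
  pr k.+1 (pD :: nseq m.-1 pW ++ [:: pD]) = p ^+ m.-1 * r ^+ 2 *
    (run k (3 + m) pN + run k (3 + m) pW
     - 2 * pr k (nseq 3 pW ++ nseq m pN)).
Proof.
(* By [site_D], each end contributes three [pN] minus three [pW]. As [m < 4], the two triples leave
   no gap, and their product gives two pure and two mixed words; the latter are mirror images. *)
move=> m14; have mirror : pr k (nseq m pN ++ nseq 3 pW) =
    pr k (nseq 3 pW ++ nseq m pN) by rewrite -pr_rev rev_cat !rev_nseq.
rewrite (@pr_step k _
  [:: (p ^+ m.-1 * r ^+ 2, nseq (3 + m) pN);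
  (p ^+ m.-1 * r ^+ 2, nseq (3 + m) pW);
  (- (p ^+ m.-1 * r ^+ 2), nseq 3 pW ++ nseq m pN);
  (- (p ^+ m.-1 * r ^+ 2), nseq m pN ++ nseq 3 pW)]).
- by rewrite !big_cons big_nil /= mirror; ring.
- by move: m m14 {mirror} => [|[|[|[|m]]]].
move: m m14 {mirror} => [|[|[|[|m]]]] // _ u /=;
  case: u => [|x0 [|x1 [|x2 [|x3 u]]]] //.
- case: u => // _; rewrite !big_cons big_nil /ind /= !site_D /= -!mulnb !natrM.
  case: (NWP x0) => [w0|]; case: (NWP x1) => [[]|]; case: (NWP x2) => [[]|];
  by case: (NWP x3) => [w3|]; rewrite /=; ring.
- case: u => [|x4 [|//]] // _.
  rewrite !big_cons big_nil /ind /= !site_D !dualNW /= -!mulnb !natrM /r.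
  case: (NWP x0) => [w0|]; case: (NWP x1) => [w1|]; case: (NWP x2) => [[]|];
  by case: (NWP x3) => [w3|]; case: (NWP x4) => [w4|]; rewrite /=; ring.
- case: u => [|x4 [|x5 [|//]]] // _.
  rewrite !big_cons big_nil /ind /= !site_D !dualNW /= -!mulnb !natrM /r.
  case: (NWP x0) => [w0|]; case: (NWP x1) => [w1|]; case: (NWP x2) => [w2|];
  by case: (NWP x3) => [w3|]; case: (NWP x4) => [w4|];
    case: (NWP x5) => [w5|]; rewrite /=; ring.
Qed.

(** * The Lyapunov function *)

Definition implies (a b : letter) : bool :=
  [&& matches a Win ==> matches b Win, matches a Lose ==> matches b Lose
    & matches a Draw ==> matches b Draw].

Lemma pr_le k s t : all2 implies s t -> pr k s <= pr k t.
Proof.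
move=> st; have sz : size s = size t.
  by elim: s t st => [|a s IH] [|b t] //= /andP[_ /IH ->].
rewrite -subr_ge0 /pr sz addrC -mulN1r -expect_linear.
apply: expect_ge0 => u; rewrite mulN1r addrC subr_ge0 ler_nat /ind.
have : (all2 matches s u ==> all2 matches t u).
  elim: s t st u {sz} => [|a s IH] [|b t] //=; first by move=> _ [].
  move=> /andP[/and3P[aW aL aD] /IH {}IH] [|o u] //=.
  apply/implyP => /andP[ao su]; rewrite (implyP (IH u) su) andbT.
  by move: o ao => [[]|]; apply/implyP.
by case: (all2 _ s _) => //= ->.
Qed.

Lemma pr_cat_le k s t : pr k (s ++ t) <= pr k s.
Proof.
rewrite -[leRHS](pr_pad k 0 s (size t)); apply: pr_le.
rewrite /pad /=; elim: s => [|a s IH] /=; last by rewrite IH andbT; case: a.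
by elim: t => //= a t ->; case: a.
Qed.

Lemma pr_left k s : pr k s = pr k (pL :: s) + pr k (pW :: s) + pr k (pD :: s).
Proof.
by rewrite -[LHS]pr_T (pr_LN k [::]) (pr_N k [::]) addrA.
Qed.

Lemma cat_nseq_cons (T : Type) j (a : T) s :
  nseq j a ++ a :: s = a :: nseq j a ++ s.
Proof. by elim: j => //= j ->. Qed.

(** * Densities of runs and of clusters of draws *)

Definition delta k m := run k m pN - run k m pW.
Definition flank k m := pr k (pD :: nseq m pW).
Definition entry k m := pr k (pL :: nseq m pN) - pr k (pL :: nseq m pW).
Definition edge k m := pr k (pL :: rcons (nseq m pW) pD).

Lemma delta_succ k m : delta k m - delta k m.+1 = entry k m - flank k m.
Proof.
rewrite /delta /entry /flank [run k m pW]pr_left.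
rewrite -[run k m pN]pr_T (pr_LN k [::]) /=; ring.
Qed.

Lemma flank_rev k m : flank k m = pr k (rcons (nseq m pW) pD).
Proof. by rewrite /flank -pr_rev rev_cons rev_nseq. Qed.

Lemma flank_succ k m : edge k m <= flank k m - flank k m.+1.
Proof.
rewrite !flank_rev [X in _ <= X - _]pr_left /edge.
have := pr_ge0 k (pD :: rcons (nseq m pW) pD); rewrite /=; lra.
Qed.

Lemma entry_ge0 k m : 0 <= entry k m.
Proof.
rewrite subr_ge0; apply: pr_le => /=.
by elim: m.
Qed.

(* The run of non-losing sites begins with [j] wins and a draw, with [j < m]. *)
Lemma entry_le k m : entry k m <= \sum_(j < m) edge k j.
Proof.
have step j i : pr k (pL :: nseq j pW ++ nseq i.+1 pN) <=
    edge k j + pr k (pL :: nseq j.+1 pW ++ nseq i pN).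
  rewrite /= (pr_N k (pL :: nseq j pW)) addrC lerD //.
    rewrite -[pD :: _]cat1s catA /edge -cats1.
    exact: (pr_cat_le k (pL :: (nseq j pW ++ [:: pD]))).
  by rewrite /= cat_nseq_cons.
have main j i : pr k (pL :: nseq j pW ++ nseq i pN) <=
    pr k (pL :: nseq (j + i) pW) + \sum_(j <= l < j + i) edge k l.
  elim: i j => [|i IH] j.
    by rewrite addn0 cats0 big_geq // addr0.
  apply: le_trans (step j i) _; have := IH j.+1; rewrite addSnnS.
  rewrite [X in _ -> _ <= _ + X]big_ltn ?addnS ?ltnS ?leq_addr //; lra.
have := main 0%N m; rewrite /= add0n big_mkord /entry; lra.
Qed.

Definition lambda k := edge k 0 + edge k 1 + edge k 2.

Lemma lambda_ge0 k : 0 <= lambda k.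
Proof. by rewrite !addr_ge0 ?pr_ge0. Qed.

(** Draws, minus those followed by another draw after at most two wins: each cluster is counted at
    its last draw. *)
Definition clusters k := pr k [:: pD] - pr k [:: pD; pD]
  - pr k [:: pD; pW; pD] - pr k [:: pD; pW; pW; pD].

(** Counts each cluster at its first draw instead: just before it come either a loss and at most two
    wins, or three wins. *)
Lemma clustersE k : clusters k = lambda k + flank k 3.
Proof.
rewrite /clusters /lambda /edge flank_rev /=.
rewrite [pr k [:: pD]]pr_left [pr k [:: pW; pD]]pr_left.
by rewrite [pr k [:: pW; pW; pD]]pr_left; ring.
Qed.

Lemma clusters_step k : clusters k.+1 = r * delta k 3 - r ^+ 2 *
  ((run k 4 pN + run k 4 pW - 2 * pr k (nseq 3 pW ++ nseq 1 pN))
   + p * (run k 5 pN + run k 5 pW - 2 * pr k (nseq 3 pW ++ nseq 2 pN))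
   + p ^+ 2 * (run k 6 pN + run k 6 pW - 2 * pr k (nseq 3 pW ++ nseq 3 pN))).
Proof.
rewrite /clusters pr_step_D (pr_step_DD k (m := 1)) //.
rewrite (pr_step_DD k (m := 2)) // (pr_step_DD k (m := 3)) //.
rewrite /delta /r; ring.
Qed.

(** Replace the [pN] by [pW] one at a time from the left; the error made after [j] wins begins with
    [j] wins and a draw, a reflected flank. *)
Lemma WN_le k m : pr k (nseq 3 pW ++ nseq m.+1 pN) <=
  run k (m.+4) pW + \sum_(3 <= j < m.+4) flank k j.
Proof.
have main j i : pr k (nseq j pW ++ nseq i pN) <=
    run k (j + i) pW + \sum_(j <= l < j + i) flank k l.
  elim: i j => [|i IH] j; first by rewrite addn0 cats0 big_geq // addr0.
  have := IH j.+1; rewrite addSnnS /= (pr_N k (nseq j pW)).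
  rewrite [X in _ -> _ <= _ + X]big_ltn ?addnS ?ltnS ?leq_addr //.
  rewrite cat_nseq_cons.
  have : pr k (nseq j pW ++ pD :: nseq i pN) <= flank k j.
    by rewrite flank_rev -cat_rcons pr_cat_le.
  lra.
by have := main 3%N m.+1; rewrite addSnnS.
Qed.

Lemma WN1 k : pr k (nseq 3 pW ++ nseq 1 pN) = run k 4 pW + flank k 3.
Proof. by rewrite flank_rev (pr_N k (nseq 3 pW)). Qed.

(** Look at the three sites to the left of a draw. If none is a loss, [delta k 4] counts the word;
    otherwise, from the nearest loss on, it begins with a loss, at most two wins and a draw. Each of
    the three positions of that loss costs at most [lambda k]. *)
Lemma draw_le k : pr k [:: pD] <= delta k 4 + 3 * lambda k.
Proof.
have ge0 := pr_ge0 k.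
have T1 s : pr k s = pr k (pL :: s) + pr k (pN :: s).
  by rewrite -[LHS]pr_T (pr_LN k [::]).
have h1 : pr k [:: pL; pN; pD] <= edge k 0 + edge k 1.
  rewrite (pr_N k [:: pL] [:: pD]) addrC lerD //.
  exact: (pr_cat_le k [:: pL; pD] [:: pD]).
have h2 : pr k [:: pL; pN; pN; pD] <= lambda k.
  rewrite (pr_N k [:: pL]) (pr_N k [:: pL; pW]) /=.
  have := pr_cat_le k [:: pL; pD] [:: pN; pD].
  have := pr_cat_le k [:: pL; pW; pD] [:: pD].
  rewrite /lambda /edge /=; lra.
have h3 : pr k [:: pN; pN; pN; pD] <= delta k 4.
  rewrite /delta (pr_N k [:: pN; pN; pN] [::]) /=.
  have : run k 4 pW <= pr k [:: pN; pN; pN; pW] by apply: pr_le.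
  by rewrite /=; lra.
rewrite T1 [pr k [:: pN; pD]]T1 [pr k [:: pN; pN; pD]]T1.
have := ge0 [:: pL; pW; pW; pD]; have := ge0 [:: pL; pW; pD].
rewrite /lambda /edge /= in h1 h2 *; lra.
Qed.

Definition lyapunov k := Yc p * (delta k 3 + clusters k) - Zc p * delta k 4.

(* Summation by parts, [delta m - delta m.+1 = entry m - flank m], after moving
   the whole sum of the coefficients to [delta 4]. *)
Lemma lyapunov_loss k : exists B C : R,
  [/\ B <= flank k 3 + flank k 4, C <= flank k 3 + flank k 4 + flank k 5 &
  lyapunov k - lyapunov k.+1 = Yc p * (lambda k + flank k 3)
  + (c3 p q + c4 p q + c5 p q + c6 p q) * delta k 4
  + c3 p q * (entry k 3 - flank k 3)
  - (c5 p q + c6 p q) * (entry k 4 - flank k 4)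
  - c6 p q * (entry k 5 - flank k 5)
  - 2 * Yc p * r ^+ 2 * (flank k 3 + p * B + p ^+ 2 * C)].
Proof.
(* [B] and [C] are the excess of the mixed words of [clusters_step] over runs of wins. Upper bounds
   suffice, as both enter the loss with a nonpositive coefficient. *)
exists (pr k (nseq 3 pW ++ nseq 2 pN) - run k 5 pW).
exists (pr k (nseq 3 pW ++ nseq 3 pN) - run k 6 pW); split.
- rewrite lerBlDl; apply: le_trans (WN_le k 1) _.
  by rewrite 2?big_ltn // big_geq // addr0.
- rewrite lerBlDl; apply: le_trans (WN_le k 2) _.
  by rewrite 3?big_ltn // big_geq // addr0 !addrA.
have e3 : entry k 3 - flank k 3 = delta k 3 - delta k 4 by rewrite delta_succ.
have e4 : entry k 4 - flank k 4 = delta k 4 - delta k 5 by rewrite delta_succ.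
have e5 : entry k 5 - flank k 5 = delta k 5 - delta k 6 by rewrite delta_succ.
rewrite e3 e4 e5 /lyapunov clusters_step clustersE WN1.
rewrite /delta (pr_step3 k dualWN) (pr_step3 k dualNW).
rewrite (pr_step4 k dualWN) (pr_step4 k dualNW).
rewrite /c6 /c5 /c4 /c3 /Yc /Zc /r.
ring.
Qed.

Lemma lyapunov_decr : 0 < r -> 0 < p + q -> exists2 eps : R, 0 < eps &
  forall k, eps * pr k [:: pD] <= lyapunov k - lyapunov k.+1.
Proof.
move=> r_gt0 pq0.
have sg := sigma_gt0 p0 q0 r0 pq0.
have l1 := lambda1_gt0 p0 q0 r0 r_gt0.
have l2 := lambda2_gt0 p0 q0 r0 r_gt0 pq0.
set sigma := _ + c6 p q in sg; set lam1 := _ - _ in l1; set lam2 := _ - _ in l2.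
(* The divisor 3 compensates the factor of [lambda k] in [draw_le]. *)
pose eps := Num.min sigma (Num.min (lam1 / 3) (lam2 / 3)).
have eps_sg : eps <= sigma by rewrite ge_min lexx.
have eps_l1 : 3 * eps <= lam1.
  by rewrite mulrC -ler_pdivlMr // !ge_min lexx orbT.
have eps_l2 : 3 * eps <= lam2.
  by rewrite mulrC -ler_pdivlMr // !ge_min lexx !orbT.
exists eps => [|k]; first by rewrite !lt_min sg !divr_gt0.
have [B [C [BE CE ->]]] := lyapunov_loss k.
have lam0 := lambda_ge0 k.
have d4 : 0 <= delta k 4 by rewrite subr_ge0; apply: pr_le.
have D : eps * pr k [:: pD] <= sigma * delta k 4 + eps * (3 * lambda k).
  apply: (le_trans (ler_wpM2l _ (draw_le k))).
    by rewrite !le_min !ltW ?divr_gt0.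
  by rewrite mulrDr lerD2r ler_wpM2r.
have e3 : entry k 3 <= lambda k.
  apply: le_trans (entry_le k 3) _.
  by rewrite !big_ord_recl big_ord0 /lambda /= addr0 addrA.
have e4 : entry k 4 <= lambda k + edge k 3.
  apply: le_trans (entry_le k 4) _.
  by rewrite !big_ord_recr big_ord0 /lambda /= add0r.
have e5 : entry k 5 <= lambda k + edge k 3 + edge k 4.
  apply: le_trans (entry_le k 5) _.
  by rewrite !big_ord_recr big_ord0 /lambda /= add0r.
have Y0 : 0 <= Yc p by apply: Yc_ge0 p0 q0 r0.
have K0 : 0 <= 2 * Yc p * r ^+ 2 by rewrite !mulr_ge0 ?exprn_ge0.
(* The sign of [c3] varies with [p] and [q]: if nonnegative, its term is dropped; otherwise
   [entry k 3] is bounded by [lambda k], which turns [lam1] into [lam2]. *)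
have E : 3 * eps * lambda k <= lam1 * lambda k + c3 p q * entry k 3.
  have [c3_0|c3_0] := leP 0 (c3 p q).
    by rewrite ler_wpDr ?mulr_ge0 ?entry_ge0 // ler_wpM2r.
  apply: le_trans (ler_wpM2r lam0 eps_l2) _.
  have := ler_wnM2l (ltW c3_0) e3; rewrite /lam1 /lam2; lra.
have f3 := flank_succ k 3; have f4 := flank_succ k 4.
have F : 0 <= flank k 5 by rewrite pr_ge0.
have E3 : 0 <= edge k 3 by rewrite pr_ge0.
have E4 : 0 <= edge k 4 by rewrite pr_ge0.
have c6_0 : 0 <= c6 p q by apply: c6_ge0.
have c5_0 : 0 <= c5 p q by apply: c5_ge0.
have h1 : 0 <= S3 p q * (flank k 3 - flank k 4 - edge k 3).
  by rewrite mulr_ge0 ?S3_ge0 // subr_ge0.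
have h2 : 0 <= S4 p q * (flank k 4 - flank k 5 - edge k 4).
  by rewrite mulr_ge0 ?S4_ge0 // subr_ge0.
have h3 : 0 <= S5 p q * flank k 5 by rewrite mulr_ge0 ?S5_ge0.
have h4 : 0 <= (S3 p q - c5 p q - 2 * c6 p q) * edge k 3.
  by rewrite mulr_ge0 ?S3_sub_ge0.
have h5 : 0 <= (S4 p q - c6 p q) * edge k 4 by rewrite mulr_ge0 ?S4_sub_ge0.
have h6 : 0 <= 2 * Yc p * r ^+ 2 * (p * (flank k 3 + flank k 4 - B)).
  by rewrite (mulr_ge0 K0) // mulr_ge0 ?subr_ge0.
have h7 : 0 <= 2 * Yc p * r ^+ 2 *
    (p ^+ 2 * (flank k 3 + flank k 4 + flank k 5 - C)).
  by rewrite (mulr_ge0 K0) // mulr_ge0 ?exprn_ge0 ?subr_ge0.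
have h8 : 0 <= (c5 p q + c6 p q) * (lambda k + edge k 3 - entry k 4).
  by rewrite mulr_ge0 ?subr_ge0 // addr_ge0.
have h9 : 0 <= c6 p q * (lambda k + edge k 3 + edge k 4 - entry k 5).
  by rewrite mulr_ge0 ?subr_ge0.
apply: (le_trans D); rewrite -subr_ge0.
set H := (X in 0 <= X).
have -> : H = (lam1 * lambda k + c3 p q * entry k 3 - 3 * eps * lambda k)
  + S3 p q * (flank k 3 - flank k 4 - edge k 3)
  + S4 p q * (flank k 4 - flank k 5 - edge k 4)
  + S5 p q * flank k 5 + (S3 p q - c5 p q - 2 * c6 p q) * edge k 3
  + (S4 p q - c6 p q) * edge k 4
  + 2 * Yc p * r ^+ 2 * (p * (flank k 3 + flank k 4 - B))
  + 2 * Yc p * r ^+ 2 * (p ^+ 2 * (flank k 3 + flank k 4 + flank k 5 - C))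
  + (c5 p q + c6 p q) * (lambda k + edge k 3 - entry k 4)
  + c6 p q * (lambda k + edge k 3 + edge k 4 - entry k 5).
  rewrite /H /lam1 /sigma /S5 /S4 /S3 -/r; ring.
by rewrite -subr_ge0 in E; do 9!(apply: addr_ge0 => //).
Qed.

Lemma pr_le1 k s : pr k s <= 1.
Proof. by rewrite -(pr_nil k); apply: (pr_cat_le k [::] s). Qed.

Lemma lyapunov_ge k : - `|Zc p| <= lyapunov k.
Proof.
have d1 : `|delta k 4| <= 1.
  have := pr_ge0 k (nseq 4 pN); have := pr_ge0 k (nseq 4 pW).
  have := pr_le1 k (nseq 4 pN); have := pr_le1 k (nseq 4 pW).
  by rewrite ler_norml /delta => *; apply/andP; split; lra.
have pos : 0 <= Yc p * (delta k 3 + clusters k).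
  rewrite mulr_ge0 ?(Yc_ge0 p0 q0 r0) // addr_ge0 //.
    by rewrite subr_ge0; apply: pr_le.
  by rewrite clustersE addr_ge0 ?lambda_ge0 ?pr_ge0.
have : `|Zc p * delta k 4| <= `|Zc p| by rewrite normrM ler_piMr.
by rewrite ler_norml /lyapunov => /andP[_ ?]; lra.
Qed.

(* The decrements of the Lyapunov function are summable. *)
Lemma draw_limit (x : R) : 0 < p + q -> (forall k, x <= pr k [:: pD]) -> x <= 0.
Proof.
(* For [r = 0] draws vanish after one step; otherwise [lyapunov_decr] applies. *)
move=> pq0 xle; have [r_gt0|] := ltP 0 r; last first.
  rewrite le_eqVlt ltNge r0 orbF => /eqP rE.
  by apply: le_trans (xle 1%N) _; rewrite pr_step_D -/r rE mul0r.
have [eps eps0 decr] := lyapunov_decr r_gt0 pq0.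
rewrite leNgt; apply/negP => x0.
have tel n : n%:R * (eps * x) <= lyapunov 0 - lyapunov n.
  elim: n => [|n IH]; first by rewrite mul0r subrr.
  have := decr n; have := ler_wpM2l (ltW eps0) (xle n).
  by rewrite mulrSr mulrDl mul1r; lra.
have ex0 : 0 < eps * x by rewrite mulr_gt0.
have := archi_boundP (x := (lyapunov 0 + `|Zc p|) / (eps * x)).
set n := Num.bound _ => bnd.
have : (lyapunov 0 + `|Zc p|) / (eps * x) < n%:R.
  apply: bnd; rewrite divr_ge0 ?(ltW ex0) //; have := lyapunov_ge 0; lra.
rewrite ltr_pdivrMr // => lt; have := tel n; have := lyapunov_ge n; lra.
Qed.

End Law.

(** * The random labelling *)

Section Discrete.
Context (d : measure_display) (T : measurableType d).

Definition discrete_measurable (U : Type) (f : T -> U) : Prop :=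
  forall B : set U, measurable (f @^-1` B).

Lemma discrete_cst (U : Type) (a : U) : discrete_measurable (fun=> a).
Proof. by move=> B; rewrite preimage_cst; case: ifP. Qed.

Lemma discrete_comp (U V : Type) (h : U -> V) f :
  discrete_measurable f -> discrete_measurable (h \o f).
Proof. by move=> mf B; rewrite comp_preimage; apply: mf. Qed.

(** The countable range of the first component slices the preimage of an arbitrary set of pairs into
    countably many measurable pieces. *)
Lemma discrete_pair (U V : Type) (e : nat -> U) (f : T -> U) (g : T -> V) :
  (forall a, exists n, e n = a) -> discrete_measurable f ->
  discrete_measurable g -> discrete_measurable (fun t => (f t, g t)).
Proof.
move=> esurj mf mg B.
have -> : (fun t => (f t, g t)) @^-1` B =
    \bigcup_n (f @^-1` [set e n] `&` g @^-1` [set b | B (e n, b)]).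
  apply/seteqP; split=> t /=.
    by have [n fE] := esurj (f t) => Bt; exists n => //; split; rewrite /= fE.
  by case=> n _ [/= -> ].
by apply: bigcupT_measurable => n; apply: measurableI; [apply: mf|apply: mg].
Qed.

Lemma discrete_map (I U : Type) (e : nat -> U) (f : I -> T -> U) (s : seq I) :
  (forall a, exists n, e n = a) -> (forall i, discrete_measurable (f i)) ->
  discrete_measurable (fun t => [seq f i t | i <- s]).
Proof.
move=> esurj mf; elim: s => [|i s IH]; first exact: discrete_cst.
exact: (discrete_comp (fun ab => ab.1 :: ab.2) (discrete_pair esurj (mf i) IH)).
Qed.

End Discrete.

Definition label_enum (n : nat) : label :=
  match n with 0 => Trap | 1 => Target | _ => Open end%N.

Lemma label_enumP l : exists n, label_enum n = l.
Proof. by case: l; [exists 0%N|exists 1%N|exists 2%N]. Qed.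

Definition outcome_enum (n : nat) : outcome :=
  match n with 0 => Win | 1 => Lose | _ => Draw end%N.

Lemma outcome_enumP o : exists n, outcome_enum n = o.
Proof. by case: o => [[]|]; [exists 0%N|exists 1%N|exists 2%N]. Qed.

Section Probability.
Context (R : realType) (p q : R) (d : measure_display) (T : measurableType d).
Context (P : probability T R) (X : vertex -> T -> label).
Hypothesis hX : random_labelling P X p q.
Variables (out : vertex -> seq vertex) (site : nat -> nat -> vertex).
Hypothesis out_site : forall n t, out (site n t) =
  [:: site n t.+1; site n.+1 t.+1; site n.+2 t.+1].
Hypothesis site_inj : forall n t n' t',
  site n t = site n' t' -> n = n' /\ t = t'.

Local Notation val k v w := (value out (X^~ w) k v).

Lemma discrete_label v : discrete_measurable (X v).
Proof. by move=> B; case: hX => mX _ _; apply: mX. Qed.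

Lemma discrete_value k v : discrete_measurable (fun w => val k v w).
Proof.
elim: k v => [|k IH] v; first exact: discrete_cst.
apply: (discrete_comp (fun ab => resolve ab.1 ab.2) (discrete_pair label_enumP
  (discrete_label v) _)).
exact: (discrete_map (out v) outcome_enumP (fun u => IH u)).
Qed.

Definition labels (n t m : nat) (w : T) : seq label :=
  [seq X (site i t) w | i <- iota n m].

Definition window (k n t m : nat) (w : T) : seq outcome :=
  [seq val k (site i t) w | i <- iota n m].

Lemma window_step k n t m w :
  window k.+1 n t m w = step (labels n t m w) (window k n t.+1 m.+2 w).
Proof.
elim: m n => // m IH n.
rewrite -[LHS]/(val k.+1 (site n t) w :: window k.+1 n.+1 t m w) IH.
by rewrite /= out_site.
Qed.

(** * Independence of the labels and the law of a window *)

Definition prob (A : set T) : R := fine (P A).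

Lemma probE A : measurable A -> P A = (prob A)%:E.
Proof. by move=> mA; rewrite /prob fineK // fin_num_measure. Qed.

Definition labelled (s : seq vertex) (A : vertex -> set label) : set T :=
  \bigcap_(v in [set` s]) (X v @^-1` A v).

Lemma measurable_labelled s A : measurable (labelled s A).
Proof.
by apply: fin_bigcap_measurable => // v _; apply: discrete_label.
Qed.

Definition put (A : vertex -> set label) v l :=
  fun u => if u == v then [set l] else A u.

Lemma labelled_put s A v l : v \notin s ->
  labelled (v :: s) (put A v l) = labelled s A `&` X v @^-1` [set l].
Proof.
move=> vs; apply/seteqP; split=> w.
  move=> h; split; last by have := h v (mem_head _ _); rewrite /put /= eqxx.
  move=> u us; have := h u; rewrite /= inE us orbT => /(_ isT).
  by rewrite /put; case: eqP => // uv; move: vs; rewrite -uv us.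
move=> [h wl] u /=; rewrite inE /put => /orP[/eqP->|us]; first by rewrite eqxx.
by case: eqP => [->|_] //; apply: h.
Qed.

Lemma prob_put s A v l : uniq (v :: s) ->
  prob (labelled (v :: s) (put A v l)) = prob (labelled s A) * label_law p q l.
Proof.
move=> /= /andP[vs us]; case: hX => _ law indep.
rewrite mulrC /prob /labelled !indep /= ?vs // big_cons {1}/put eqxx law.
rewrite (eq_big_seq (fun u => P (X u @^-1` A u))); last first.
  by move=> u us'; rewrite /put; case: eqP => // uv; move: vs; rewrite -uv us'.
by rewrite -indep // probE ?fineM //; apply: measurable_labelled.
Qed.

Lemma prob_split_label v (A : set T) : measurable A ->
  prob A = prob (A `&` X v @^-1` [set Trap])
    + prob (A `&` X v @^-1` [set Target]) + prob (A `&` X v @^-1` [set Open]).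
Proof.
move=> mA; have mAl l : measurable (A `&` X v @^-1` [set l]).
  by apply: measurableI => //; apply: discrete_label.
apply: EFin_inj; rewrite !EFinD -!probE //.
rewrite -measureU //; last first.
  by rewrite -subset0 => w /= [[_ ->] [_]].
rewrite -measureU //; last 2 first.
- exact: measurableU.
- by rewrite -subset0 => w /= [[] [_ ->] [_]].
congr (P _); apply/seteqP; split=> w /=; last by case=> [[]|] [].
by move=> Aw; case: (X v w); [left;left|left;right|right].
Qed.

Definition below (t : nat) (u : vertex) : Prop :=
  exists i t', u = site i t' /\ (t' < t)%N.

Lemma measurable_joint (vs : seq vertex) k n t m
    (phi : seq label -> seq outcome -> bool) :
  measurable [set w | phi [seq X v w | v <- vs] (window k n t m w)].
Proof.
have mwin : discrete_measurable (fun w => window k n t m w).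
  exact: (discrete_map (iota n m) outcome_enumP
    (fun i => discrete_value k (site i t))).
elim: vs phi => [|v vs IH] phi /=; first exact: (mwin [set u | phi [::] u]).
have -> : [set w | phi (X v w :: [seq X v w | v <- vs]) (window k n t m w)] =
   \bigcup_i (X v @^-1` [set label_enum i] `&`
     [set w | phi (label_enum i :: [seq X v w | v <- vs]) (window k n t m w)]).
  apply/seteqP; split=> w /=.
    have [i iE] := label_enumP (X v w) => h.
    by exists i => //; split; rewrite /= iE.
  by case=> i _ [/= ->].
apply: bigcupT_measurable => i; apply: measurableI; first exact: discrete_label.
exact: (IH (fun ls => phi (label_enum i :: ls))).
Qed.

(* By induction on [k]: the labels of level [t] are independent of those of the
   lower levels, collected in [s], and of the window at level [t + 1]. *)
Lemma window_law k s A n t m (phi : seq outcome -> bool) :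
  uniq s -> (forall u, u \in s -> below t u) ->
  prob (labelled s A `&` [set w | phi (window k n t m w)]) =
  prob (labelled s A) * expect p q k m (fun u => (phi u)%:R).
Proof.
elim: k s A n t m phi => [|k IH] s A n t m phi us sb.
  have -> : [set w | phi (window 0 n t m w)] =
      if phi (nseq m Draw) then setT else set0.
    have E w : window 0 n t m w = nseq m Draw.
      by rewrite /window; elim: m {phi} n => //= m IH n; rewrite IH.
    by case: ifP => h; apply/seteqP; split=> w; rewrite /= E h.
  rewrite /=; case: ifP => _; first by rewrite setIT mulr1.
  by rewrite setI0 mulr0 /prob measure0.
(* The labels of [vs] are revealed one at a time: each value joins the conditioning event through
   [put], which moves its vertex from [vs] to [s]. *)
have joint vs (psi : seq label -> seq outcome -> bool) : uniq (vs ++ s) ->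
    (forall u, u \in vs ++ s -> below t.+1 u) ->
    prob (labelled s A `&`
      [set w | psi [seq X v w | v <- vs] (window k n t.+1 m.+2 w)]) =
    prob (labelled s A) * avg p q (size vs)
      (fun ls => expect p q k m.+2 (fun u => (psi ls u)%:R)).
  elim: vs s A {us sb} psi => [|v vs IHvs] s A psi usv vsb.
    exact: (IH _ _ _ _ _ (psi [::])).
  rewrite (prob_split_label v); last first.
    exact/measurableI/(measurable_joint (v :: vs))/measurable_labelled.
  have pe : perm_eq (vs ++ v :: s) (v :: vs ++ s).
    by rewrite -(cat1s v s) perm_catCA.
  have uvs : uniq (vs ++ v :: s) by rewrite (perm_uniq pe).
  have v_s : v \notin s.
    by move: usv; rewrite cat_cons /= mem_cat negb_or => /andP[/andP[]].
  have uv_s : uniq (v :: s) by move: uvs; rewrite cat_uniq => /and3P[].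
  have E l : prob (labelled s A `&`
        [set w | psi [seq X v w | v <- v :: vs] (window k n t.+1 m.+2 w)]
        `&` X v @^-1` [set l]) =
      prob (labelled s A) * label_law p q l * avg p q (size vs)
      (fun ls => expect p q k m.+2 (fun u => (psi (l :: ls) u)%:R)).
    rewrite -(@prob_put s A v l) //.
    rewrite -(IHvs _ _ (fun ls => psi (l :: ls))) //; last first.
      by move=> u; rewrite (perm_mem pe); apply: vsb.
    rewrite labelled_put //; congr prob; apply/seteqP; split=> w /=.
      by move=> [[h1 h2] h3]; rewrite -h3.
    by move=> [[h1 h3] h2]; rewrite -h3 in h2.
  by rewrite !E /=; ring.
have -> : [set w | phi (window k.+1 n t m w)] =
    [set w | phi (step [seq X v w | v <- [seq site i t | i <- iota n m]]
      (window k n t.+1 m.+2 w))].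
  by apply/seteqP; split=> w /=; rewrite window_step /labels -map_comp.
rewrite (joint _ (fun ls u => phi (step ls u))).
- rewrite size_map size_iota; congr (_ * _) => /=.
  by rewrite expect_avg.
- rewrite cat_uniq us andbT map_inj_uniq ?iota_uniq; last first.
    by move=> i j /site_inj[].
  apply/hasPn => u /sb [i [t' [-> t't]]]; apply/mapP => -[j _ /site_inj[_ tt]].
  by move: t't; rewrite tt ltnn.
- move=> u; rewrite mem_cat => /orP[/mapP[i _ ->]|/sb [i [t' [-> t't]]]].
    by exists i, t.
  by exists i, t'; split=> //; apply: ltnW.
Qed.

Hypotheses (p0 : 0 <= p) (q0 : 0 <= q) (r0 : 0 <= 1 - p - q) (pq0 : 0 < p + q).
Hypothesis out_neq0 : forall u, out u != [::].

Lemma draw_eventE v :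
  draw_event X out v = \bigcap_k [set w | val k v w = Draw].
Proof.
apply/seteqP; split=> w; first by move=> /(classDE _ out_neq0) h k _; apply: h.
by move=> h; apply/(classDE _ out_neq0) => k; apply: h.
Qed.

Lemma measurable_draw v : measurable (draw_event X out v).
Proof.
rewrite draw_eventE; apply: bigcapT_measurable => k.
exact: (discrete_value k v [set Draw]).
Qed.

(** For every [k] a draw is still undecided at horizon [k], an event of probability [pr p q k
    [:: pD]] by [window_law] with nothing conditioned on; [draw_limit] concludes. *)
Lemma prob_draw : P (draw_event X out (site 0 0)) = 0%E.
Proof.
have mD := measurable_draw (site 0 0); rewrite probE //; congr EFin.
apply/eqP; rewrite eq_le fine_ge0 // andbT.
apply: (draw_limit p0 q0 r0 pq0) => k.
have law := @window_law k [::] (fun=> setT) 0 0 1 (all2 matches [:: pD]) isT.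
rewrite -[X in _ <= X]/(expect p q k 1 (fun u => (all2 matches [:: pD] u)%:R)).
have all_labels : labelled [::] (fun=> setT) = setT.
  by apply/seteqP; split=> // w _ u.
rewrite all_labels setTI {2}/prob probability_setT mul1r in law.
rewrite -law //; set W := [set w | _].
have mW : measurable W.
  exact: (measurable_joint [::] k 0 0 1 (fun _ => all2 matches [:: pD])).
rewrite fine_le ?fin_num_measure // le_measure ?mem_set //.
by rewrite draw_eventE => w h; rewrite /W /= (h k I).
Qed.

End Probability.

(** * Level coordinates for the three games *)

Unset Implicit Arguments.

Theorem theorem1p1 (R : realType) (p q : R) (hpq : param_region (p, q))
    (d : measure_display) (T : measurableType d) (P : probability T R)
    (X : vertex -> T -> label) (hX : random_labelling P X p q)
    (out : vertex -> seq vertex)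
    (hout : [\/ out = outV1, out = outV2 | out = outV3])
    (v : vertex) :
  measurable (draw_event X out v) /\ P (draw_event X out v) = 0%E.
Proof.
have [/= /andP[p0 _] /andP[q0 _] /andP[pq0 pq1]] := hpq.
have r0 : 0 <= 1 - p - q by rewrite -addrA -opprD subr_ge0.
have out_neq0 u : out u != [::] by case: hout => ->.
split; first exact: (measurable_draw hX out_neq0 v).
(* Only natural [n] and [t] are needed: these sites contain [v] and are closed under moves. *)
have main (site : nat -> nat -> vertex) : site 0%N 0%N = v ->
    (forall n t, out (site n t) =
      [:: site n t.+1; site n.+1 t.+1; site n.+2 t.+1]) ->
    (forall n t n' t', site n t = site n' t' -> n = n' /\ t = t') ->
    P (draw_event X out v) = 0%E.
  move=> <- out_site site_inj.
  exact: (prob_draw hX out_site site_inj p0 q0 r0 pq0 out_neq0).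
case: hout => E.
(* Each move raises [x + y] by 2: [t] is half that increase and [n] the increase of [x]. *)
- apply: (main (fun n t => (v.1 + n%:Z, v.2 + (2 * t)%N%:Z - n%:Z))).
  + by rewrite [RHS]surjective_pairing; congr pair; lia.
  + by move=> n t; rewrite E /outV1 /=; congr [:: _; _; _]; congr pair; lia.
  + by move=> n t n' t' [] h1 h2; split; lia.
- apply: (main (fun n t => (v.1 + n%:Z, v.2 + t%:Z))).
  + by rewrite [RHS]surjective_pairing; congr pair; lia.
  + by move=> n t; rewrite E /outV2 /=; congr [:: _; _; _]; congr pair; lia.
  + by move=> n t n' t' [] h1 h2; split; lia.
(* Each move raises [x + y] by 1: [t] is that increase and [n] the increase of [y]. *)
- apply: (main (fun n t => (v.1 + t%:Z - n%:Z, v.2 + n%:Z))).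
  + by rewrite [RHS]surjective_pairing; congr pair; lia.
  + by move=> n t; rewrite E /outV3 /=; congr [:: _; _; _]; congr pair; lia.
  + by move=> n t n' t' [] h1 h2; split; lia.
Qed.
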